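(* Let $\mathcal F$ be an algebraic language and $\mathbf I=(I;\mathcal F)$ a nonempty $\mathcal F$-algebra. The functor $\mathfrak M\colon(\mathsf{Alg}(\mathcal F)\downarrow\mathbf I)\to\mathsf{MSAlg}(\mathcal F_{\mathbf I})$ maps onto the full subcategory $\mathsf{MSAlg}^\Box(\mathcal F_{\mathbf I})$ and, with this target, is an isomorphism of categories $(\mathsf{Alg}(\mathcal F)\downarrow\mathbf I)\to\mathsf{MSAlg}^\Box(\mathcal F_{\mathbf I})$; it restricts to an isomorphism between $(\mathsf{Alg}(\mathcal F)\downdownarrows\mathbf I)$ and $\mathsf{MSAlg}^\boxplus(\mathcal F_{\mathbf I})$. Consequently $(\mathsf{Alg}(\mathcal F)\downarrow\mathbf I)$ is equivalent to $\mathsf{MSAlg}(\mathcal F_{\mathbf I})$, and $(\mathsf{Alg}(\mathcal F)\downdownarrows\mathbf I)$ is equivalent to $\mathsf{MSAlg}^+(\mathcal F_{\mathbf I})$.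
   Context: $(\mathsf{Alg}(\mathcal F)\downarrow\mathbf I)$: objects are pairs $(\mathbf A,\chi)$ with $\mathbf A$ an $\mathcal F$-algebra (empty universe allowed if $\mathcal F$ has no nullary symbols) and $\chi\colon\mathbf A\to\mathbf I$ a homomorphism; morphisms $(\mathbf A,\chi)\to(\mathbf B,\xi)$ are homomorphisms $\psi\colon\mathbf A\to\mathbf B$ with $\chi=\xi\circ\psi$. $(\mathsf{Alg}(\mathcal F)\downdownarrows\mathbf I)$ is its full subcategory of objects with $\chi$ onto. $\mathcal F_{\mathbf I}$ is the multisorted language with sorts indexed by $I$ and symbols $f_{\mathbf i}$ for $f\in\mathcal F$, $\mathbf i\in I^{\mathrm{ar}(f)}$, of arity $\mathrm{ar}(f)$, input sorts $\mathbf i$ and output sort $f^{\mathbf I}(\mathbf i)$. $\mathsf{MSAlg}(\mathcal F_{\mathbf I})$ is the category of multisorted $\mathcal F_{\mathbf I}$-algebras (a sort may be empty if no nullary symbol has it as output sort) with multisorted homomorphisms; $\mathsf{MSAlg}^\Box$, $\mathsf{MSAlg}^+$, $\mathsf{MSAlg}^\boxplus$ are the full subcategories of algebras whose sorts are pairwise disjoint, all nonempty, or both, respectively. $\mathfrak M(\mathbf A,\chi)$ has sorts $\chi^{-1}(i)$ ($i\in I$), with $f_{\mathbf i}$ the restriction of $f^{\mathbf A}$ to $\chi^{-1}(i_1)\times\dots\times\chi^{-1}(i_{\mathrm{ar}(f)})$; $\mathfrak M(\psi)=(\psi|_{\chi^{-1}(i)})_{i\in I}$. *)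

(* Defs.v *)
From mathcomp Require Import all_boot boolp.
From mathcomp Require Import generic_quotient.

Set Implicit Arguments.
Unset Strict Implicit.
Unset Printing Implicit Defensive.

Local Open Scope quotient_scope.
#[local] Obligation Tactic := idtac.

(* Disjointness of sorts, and equality of the objects of two categories of
   algebras, only make sense for material sets.  The universe [V] of sets is
   Aczel's type of well-founded trees modulo bisimulation: [Tree c] stands for
   the set of all [c d], so bisimilarity is extensional equality. *)

Inductive tree : Type := Tree (D : Type) of D -> tree.

Fixpoint bisim (x y : tree) : Prop :=
  let: Tree D c := x in let: Tree E d := y in
  (forall a : D, exists b : E, bisim (c a) (d b)) /\
  (forall b : E, exists a : D, bisim (c a) (d b)).

Definition classic_tree := {classic tree}.

Definition bisimb : rel classic_tree := fun x y => `[< bisim x y >].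

Lemma bisim_refl x : bisim x x.
Proof. by elim: x => D c IH /=; split=> a; exists a. Qed.

Lemma bisim_sym x y : bisim x y -> bisim y x.
Proof.
elim: x y => D c IH [E d] /= [cd dc]; split.
  by move=> b; have [a /IH ab] := dc b; exists a.
by move=> a; have [b /IH ab] := cd a; exists b.
Qed.

Lemma bisim_trans y x z : bisim x y -> bisim y z -> bisim x z.
Proof.
elim: x y z => D c IH [E d] [G e] /= [cd dc] [de ed]; split.
  by move=> a; have [b ab] := cd a; have [g bg] := de b; exists g; apply: IH bg.
by move=> g; have [b bg] := ed g; have [a ab] := dc b; exists a; apply: IH bg.
Qed.

Lemma bisimb_refl : reflexive bisimb.
Proof. by move=> x; apply/asboolP/bisim_refl. Qed.

Lemma bisimb_sym : symmetric bisimb.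
Proof. by move=> x y; apply/asboolP/asboolP; apply: bisim_sym. Qed.

Lemma bisimb_trans : transitive bisimb.
Proof.
by move=> y x z /asboolP xy /asboolP yz; apply/asboolP/(bisim_trans xy yz).
Qed.

Definition bisim_equiv := EquivRel bisimb bisimb_refl bisimb_sym bisimb_trans.

Definition V : Type := {eq_quot bisim_equiv}.

Definition piV (t : tree) : V := \pi_{eq_quot bisim_equiv} (t : classic_tree).

Definition reprV (A : V) : tree := repr (A : {eq_quot bisim_equiv}).

Definition idx (A : V) : Type := let: Tree D _ := reprV A in D.

Definition elt (A : V) : idx A -> V :=
  match reprV A as t return (let: Tree D _ := t in D) -> V with
  | Tree D c => fun d => piV (c d)
  end.

Definition inV (x A : V) : Prop := exists d : idx A, elt d = x.

Notation "x ∈ A" := (inV x A) (at level 70, no associativity).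

(* The set of the values of a family indexed by a small type. *)
Definition setof (D : Type) (f : D -> V) : V := piV (Tree (fun d => reprV (f d))).

Definition sep (A : V) (P : V -> Prop) : V :=
  setof (fun d : {d : idx A | P (elt d)} => elt (sval d)).

Lemma piV_eq s t : piV s = piV t <-> bisim s t.
Proof.
split; first by move=> /eqmodP/asboolP.
by move=> st; apply/eqmodP/asboolP.
Qed.

Lemma reprVK A : piV (reprV A) = A.
Proof. exact: reprK. Qed.

Lemma memE x A :
  x ∈ A <-> let: Tree D c := reprV A in exists d : D, piV (c d) = x.
Proof. by rewrite /inV /elt /idx; case: (reprV A). Qed.

Lemma mem_piV x D (c : D -> tree) :
  x ∈ piV (Tree c) <-> exists d, piV (c d) = x.
Proof.
rewrite memE.
have /piV_eq : piV (reprV (piV (Tree c))) = piV (Tree c) by rewrite reprVK.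
case: (reprV _) => E d /= [dc cd]; split=> [] [a <-].
  by have [b /piV_eq ab] := dc a; exists b.
by have [b /piV_eq ab] := cd a; exists b.
Qed.

Lemma mem_setof x D (f : D -> V) : x ∈ setof f <-> exists d, f d = x.
Proof.
by rewrite mem_piV; split=> [] [d <-]; exists d; rewrite reprVK.
Qed.

Lemma mem_sep x A (P : V -> Prop) : x ∈ sep A P <-> x ∈ A /\ P x.
Proof.
rewrite mem_setof; split=> [[[d Pd] <-]|[[d <-] Pd]]; first by split; first by exists d.
by exists (exist _ d Pd).
Qed.

Lemma extV A B : (forall x, x ∈ A <-> x ∈ B) -> A = B.
Proof.
move=> AB; rewrite -(reprVK A) -(reprVK B); apply/piV_eq.
have {}AB x := iff_trans (iff_sym (memE x A)) (iff_trans (AB x) (memE x B)); move: AB.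
case: (reprV A) (reprV B) => [D c] [E d] /= AB; split=> [a|b].
  by have /AB [b /esym/piV_eq ab] : exists a', piV (c a') = piV (c a);
    [exists a | exists b].
by have /AB [a /piV_eq ab] : exists b', piV (d b') = piV (d b);
  [exists b | exists a].
Qed.

Definition el (A : V) : Type := {x : V | x ∈ A}.

Lemma el_inj (A : V) (a b : el A) : sval a = sval b -> a = b.
Proof. by case: a b => [a ?] [b ?] /= ab; apply: eq_exist. Qed.

Record category := Category {
  obj :> Type;
  hom : obj -> obj -> Type;
  idm : forall x, hom x x;
  cmp : forall x y z, hom y z -> hom x y -> hom x z;
  cmp_idl : forall x y (f : hom x y), cmp (idm y) f = f;
  cmp_idr : forall x y (f : hom x y), cmp f (idm x) = f;
  cmpA : forall x y z t (h : hom z t) (g : hom y z) (f : hom x y),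
    cmp h (cmp g f) = cmp (cmp h g) f }.

Arguments hom {c} x y.
Arguments idm {c} x.
Arguments cmp {c x y z} g f.

Record functor (C D : category) := Functor {
  fobj :> C -> D;
  fmap : forall x y, hom x y -> hom (fobj x) (fobj y);
  fmap_id : forall x, fmap (idm x) = idm (fobj x);
  fmap_cmp : forall x y z (g : hom y z) (f : hom x y),
    fmap (cmp g f) = cmp (fmap g) (fmap f) }.

Arguments fmap {C D} F {x y} f : rename.

Definition id_functor (C : category) : functor C C :=
  @Functor C C id (fun _ _ f => f) (fun _ => erefl) (fun _ _ _ _ _ => erefl).

Program Definition cmp_functor (C D E : category)
    (G : functor D E) (F : functor C D) : functor C E :=
  @Functor C E (fun x => G (F x)) (fun _ _ f => fmap G (fmap F f)) _ _.
Next Obligation. by move=> * /=; rewrite !fmap_id. Qed.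
Next Obligation. by move=> * /=; rewrite !fmap_cmp. Qed.

(* Equality of functors is Leibniz equality: a strict inverse, on objects and on
   morphisms. *)
Definition cat_isomorphism (C D : category) (F : functor C D) : Prop :=
  exists G : functor D C,
    cmp_functor G F = id_functor C /\ cmp_functor F G = id_functor D.

Definition isomorphism (C : category) (x y : C) (f : hom x y) : Prop :=
  exists g : hom y x, cmp g f = idm x /\ cmp f g = idm y.

Definition naturally_isomorphic (C D : category) (F G : functor C D) : Prop :=
  exists t : forall x, hom (F x) (G x),
    (forall x y (f : hom x y), cmp (t y) (fmap F f) = cmp (fmap G f) (t x)) /\
    (forall x, isomorphism (t x)).

Definition equivalent_categories (C D : category) : Prop :=
  exists (F : functor C D) (G : functor D C),
    naturally_isomorphic (cmp_functor G F) (id_functor C) /\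
    naturally_isomorphic (cmp_functor F G) (id_functor D).

Definition full_sub (C : category) (P : C -> Prop) : category :=
  @Category {x : C | P x} (fun x y => hom (sval x) (sval y))
    (fun x => idm (sval x)) (fun _ _ _ g f => cmp g f)
    (fun _ _ f => cmp_idl f) (fun _ _ f => cmp_idr f)
    (fun _ _ _ _ h g f => cmpA h g f).

(* The functor [F] seen as having a full subcategory of [D] as its target. *)
Definition corestrict (C D : category) (F : functor C D) (Q : D -> Prop)
    (FQ : forall x, Q (F x)) : functor C (full_sub Q) :=
  @Functor C (full_sub Q) (fun x => exist _ (F x) (FQ x))
    (fun _ _ f => fmap F f) (fun x => fmap_id F x)
    (fun _ _ _ g f => fmap_cmp F g f).

Definition restrict (C D : category) (F : functor C D)
    (P : C -> Prop) (Q : D -> Prop) (FPQ : forall x, P x -> Q (F x)) :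
    functor (full_sub P) (full_sub Q) :=
  @Functor (full_sub P) (full_sub Q)
    (fun x => exist _ (F (sval x)) (FPQ (sval x) (svalP x)))
    (fun _ _ f => fmap F f) (fun x => fmap_id F (sval x))
    (fun _ _ _ g f => fmap_cmp F g f).

Definition maps_onto_full_sub (C D : category) (F : functor C D)
    (Q : D -> Prop) : Prop :=
  (forall y, Q y <-> exists x, F x = y) /\
  (forall x x' (g : hom (F x) (F x')), exists f : hom x x', fmap F f = g).

Section Slice.
Variables (C : category) (X : C).

Record slice_obj := SliceObj { slice_dom : C; slice_map : hom slice_dom X }.

Definition slice_hom (a b : slice_obj) : Type :=
  {f : hom (slice_dom a) (slice_dom b) | slice_map a = cmp (slice_map b) f}.

Program Definition slice_id (a : slice_obj) : slice_hom a a :=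
  exist _ (idm (slice_dom a)) _.
Next Obligation. by move=> a /=; rewrite cmp_idr. Qed.

Program Definition slice_cmp (a b c : slice_obj)
    (g : slice_hom b c) (f : slice_hom a b) : slice_hom a c :=
  exist _ (cmp (sval g) (sval f)) _.
Next Obligation. by move=> a b c [g gE] [f fE] /=; rewrite cmpA -gE. Qed.

Program Definition slice : category :=
  @Category slice_obj slice_hom slice_id slice_cmp _ _ _.
Next Obligation. by move=> a b [f fE]; apply: eq_exist; apply: cmp_idl. Qed.
Next Obligation. by move=> a b [f fE]; apply: eq_exist; apply: cmp_idr. Qed.
Next Obligation. by move=> *; apply: eq_exist; apply: cmpA. Qed.

End Slice.

Record language := Language { symb : Type; ar : symb -> nat }.

Section Algebras.
Variable F : language.

(* [univ] may be the empty set; [op] rules this out as soon as there is a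
   nullary symbol, ['I_0 -> el univ] being always inhabited.  The same holds for
   the sorts of a [ms_algebra] below. *)
Record algebra := Algebra {
  univ : V;
  op : forall f : symb F, ('I_(ar f) -> el univ) -> el univ }.

Record alg_hom (A B : algebra) := AlgHom {
  alg_fun :> el (univ A) -> el (univ B);
  alg_funP : forall f (a : 'I_(ar f) -> el (univ A)),
    alg_fun (op a) = op (fun k => alg_fun (a k)) }.

Lemma alg_hom_eq (A B : algebra) (g h : alg_hom A B) :
  (forall x, g x = h x) -> g = h.
Proof.
case: g h => [g gP] [h hP] /= /funext gh; case: _ / gh hP => hP.
by congr AlgHom; apply: Prop_irrelevance.
Qed.

Definition alg_id (A : algebra) : alg_hom A A :=
  @AlgHom A A id (fun _ _ => erefl).

Program Definition alg_cmp (A B C : algebra)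
    (h : alg_hom B C) (g : alg_hom A B) : alg_hom A C :=
  @AlgHom A C (fun x => h (g x)) _.
Next Obligation. by move=> * /=; rewrite !alg_funP. Qed.

Program Definition Alg : category :=
  @Category algebra alg_hom alg_id alg_cmp _ _ _.
Next Obligation. by move=> *; apply: alg_hom_eq. Qed.
Next Obligation. by move=> *; apply: alg_hom_eq. Qed.
Next Obligation. by move=> *; apply: alg_hom_eq. Qed.

End Algebras.

Record ms_language := MSLanguage {
  sort : Type;
  ms_symb : Type;
  ms_ar : ms_symb -> nat;
  in_sort : forall s : ms_symb, 'I_(ms_ar s) -> sort;
  out_sort : ms_symb -> sort }.

Section MultisortedAlgebras.
Variable L : ms_language.

Record ms_algebra := MSAlgebra {
  ms_univ : sort L -> V;
  ms_op : forall s : ms_symb L,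
    (forall k : 'I_(ms_ar s), el (ms_univ (in_sort k))) ->
    el (ms_univ (out_sort s)) }.

Record ms_hom (A B : ms_algebra) := MSHom {
  ms_fun :> forall i, el (ms_univ A i) -> el (ms_univ B i);
  ms_funP : forall s (a : forall k : 'I_(ms_ar s), el (ms_univ A (in_sort k))),
    ms_fun (ms_op a) = ms_op (fun k => ms_fun (a k)) }.

Lemma ms_hom_eq (A B : ms_algebra) (g h : ms_hom A B) :
  (forall i x, g i x = h i x) -> g = h.
Proof.
case: g h => [g gP] [h hP] /= gh.
have {}gh : g = h by apply: functional_extensionality_dep => i; apply/funext/gh.
case: _ / gh hP => hP.
by congr MSHom; apply: Prop_irrelevance.
Qed.

Definition ms_id (A : ms_algebra) : ms_hom A A :=
  @MSHom A A (fun _ x => x) (fun _ _ => erefl).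

Program Definition ms_cmp (A B C : ms_algebra)
    (h : ms_hom B C) (g : ms_hom A B) : ms_hom A C :=
  @MSHom A C (fun i x => h i (g i x)) _.
Next Obligation. by move=> * /=; rewrite !ms_funP. Qed.

Program Definition MSAlg : category :=
  @Category ms_algebra ms_hom ms_id ms_cmp _ _ _.
Next Obligation. by move=> *; apply: ms_hom_eq. Qed.
Next Obligation. by move=> *; apply: ms_hom_eq. Qed.
Next Obligation. by move=> *; apply: ms_hom_eq. Qed.

Definition disjoint_sorts (A : MSAlg) : Prop :=
  forall i j, i <> j -> ~ exists x, x ∈ ms_univ A i /\ x ∈ ms_univ A j.

Definition nonempty_sorts (A : MSAlg) : Prop :=
  forall i, exists x, x ∈ ms_univ A i.

Definition MSAlg_box : category := full_sub disjoint_sorts.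

Definition MSAlg_plus : category := full_sub nonempty_sorts.

Definition disjoint_nonempty_sorts (A : MSAlg) : Prop :=
  disjoint_sorts A /\ nonempty_sorts A.

Definition MSAlg_boxplus : category := full_sub disjoint_nonempty_sorts.

End MultisortedAlgebras.

Section FunctorM.
Variables (F : language) (I : Alg F).

Definition sorted_language : ms_language :=
  @MSLanguage (el (univ I)) {f : symb F & 'I_(ar f) -> el (univ I)}
    (fun s => ar (tag s)) (fun s => tagged s) (fun s => op (tagged s)).

Definition comma : category := slice I.

Definition onto_obj (a : comma) : Prop :=
  forall i : el (univ I), exists x, (slice_map a : alg_hom _ _) x = i.

Definition comma_onto : category := full_sub onto_obj.

Section Fibers.
Variables (A : algebra F) (chi : alg_hom A I).

Definition fiber (i : el (univ I)) : V :=
  sep (univ A) (fun x => exists Ax : x ∈ univ A, chi (exist _ x Ax) = i).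

Definition fiber_val i (x : el (fiber i)) : el (univ A) :=
  exist _ (sval x) (proj1 ((mem_sep _ _ _).1 (svalP x))).

Lemma fiber_valP i (x : el (fiber i)) : chi (fiber_val x) = i.
Proof.
case: x => x xi; have [_ [Ax xiE]] := (mem_sep _ _ _).1 xi.
by rewrite -[RHS]xiE; congr (chi _); apply: el_inj.
Qed.

Lemma mem_fiber i (a : el (univ A)) : chi a = i -> sval a ∈ fiber i.
Proof. by case: a => a Aa ai; apply/mem_sep; split=> //; exists Aa. Qed.

Definition to_fiber i (a : el (univ A)) (ai : chi a = i) : el (fiber i) :=
  exist _ (sval a) (mem_fiber ai).

Lemma op_fiber (f : symb F) (i : 'I_(ar f) -> el (univ I))
    (a : forall k, el (fiber (i k))) :
  chi (op (fun k => fiber_val (a k))) = op i.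
Proof.
by rewrite alg_funP; congr op; apply/funext => k; apply: fiber_valP.
Qed.

End Fibers.

Definition M_obj (a : comma) : MSAlg sorted_language :=
  @MSAlgebra sorted_language (fiber (slice_map a))
    (fun s args => to_fiber (op_fiber args)).

Section Restriction.
Variables (a b : comma) (psi : hom a b).

Lemma psi_fiber i (x : el (fiber (slice_map a) i)) :
  (slice_map b : alg_hom _ _) ((sval psi : alg_hom _ _) (fiber_val x)) = i.
Proof.
rewrite -[RHS](fiber_valP x).
by case: psi => g /= /(congr1 (fun h : alg_hom _ _ => h (fiber_val x))) ->.
Qed.

Program Definition M_hom : hom (M_obj a) (M_obj b) :=
  @MSHom _ (M_obj a) (M_obj b) (fun i x => to_fiber (psi_fiber x)) _.
Next Obligation.
move=> s args; apply: el_inj => /=.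
rewrite (_ : fiber_val _ = op (fun k => fiber_val (args k))); last exact: el_inj.
by rewrite alg_funP; congr (sval (op _)); apply/funext => k; apply: el_inj.
Qed.

End Restriction.

Program Definition M : functor comma (MSAlg sorted_language) :=
  @Functor _ (MSAlg sorted_language) M_obj M_hom _ _.
Next Obligation. by move=> a; apply: ms_hom_eq => i x; apply: el_inj. Qed.
Next Obligation.
move=> a b c g f; apply: ms_hom_eq => i x; apply: el_inj => /=.
by congr (sval (_ _)); apply: el_inj.
Qed.

End FunctorM.

(* Main.v *)
From mathcomp Require Import all_boot boolp.
Require Import Defs.

(** The functor [M] is fully faithful, and an algebra over [I] is recovered from
    its fibers: its universe is their union, each element belongs to exactly one
    of them, and the operation [f] is glued from the [f_i].  This makes [M]
    injective on objects; glueing an arbitrary algebra with disjoint sorts shows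
    that [M] reaches all of these.  A fully faithful functor that is bijective on
    objects is an isomorphism.  Replacing each sort [A_i] by [{i} * A_i] makes the
    sorts disjoint without changing the isomorphism class, so [M] is also
    essentially surjective onto all multisorted algebras. *)

Set Implicit Arguments.
Unset Strict Implicit.
Unset Printing Implicit Defensive.

(** * Fully faithful functors *)

Definition full (C D : category) (F : functor C D) : Prop :=
  forall x y (g : hom (F x) (F y)), exists f : hom x y, fmap F f = g.

Definition faithful (C D : category) (F : functor C D) : Prop :=
  forall x y (f g : hom x y), fmap F f = fmap F g -> f = g.

(** Turning equalities of objects into morphisms avoids transporting hom-sets along them. *)
Definition id_to_hom (C : category) (x y : C) (e : x = y) : hom x y :=
  let: erefl := e in idm x.

Lemma id_to_hom_iso (C : category) (x y : C) (e : x = y) :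
  isomorphism (id_to_hom e).
Proof. by case: y / e; exists (idm x); split; apply: cmp_idl. Qed.

Lemma fmap_id_to_hom (C D : category) (F : functor C D) (x y : C) (e : x = y)
    (e' : F x = F y) : fmap F (id_to_hom e) = id_to_hom e'.
Proof. by case: y / e e' => e'; rewrite (Prop_irrelevance e' erefl) fmap_id. Qed.

(** The squares compare the morphism parts without casts. Once the object parts are identified, each
    [e x] is a proof of a reflexive equality, so by proof irrelevance it induces an identity. *)
Lemma functor_eq (C D : category) (F G : functor C D) (e : forall x, F x = G x) :
  (forall x y (f : hom x y),
     cmp (id_to_hom (e y)) (fmap F f) = cmp (fmap G f) (id_to_hom (e x))) ->
  F = G.
Proof.
case: F G e => [Fo Fm Fi Fc] [Go Gm Gi Gc] /= e.
have E : Fo = Go by apply/funext.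
case: _ / E Gm Gi Gc e => Gm Gi Gc e FG.
have E : Fm = Gm.
  apply: functional_extensionality_dep => x.
  apply: functional_extensionality_dep => y; apply/funext => f.
  have := FG x y f.
  by rewrite (Prop_irrelevance (e x) erefl) (Prop_irrelevance (e y) erefl)
    /= cmp_idl cmp_idr.
case: _ / E Gi Gc {FG} => Gi Gc.
by congr Functor; apply: Prop_irrelevance.
Qed.

Section FullyFaithful.
Variables (C D : category) (F : functor C D).
Hypotheses (Ffull : full F) (Ffaithful : faithful F).

Definition full_lift x y (g : hom (F x) (F y)) : hom x y := sval (cid (Ffull g)).

Lemma full_liftK x y (g : hom (F x) (F y)) : fmap F (full_lift g) = g.
Proof. exact: svalP (cid (Ffull g)). Qed.

Section QuasiInverse.
Variables (G : D -> C) (t : forall d, hom (F (G d)) d).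
Variables (s : forall d, hom d (F (G d))).
Hypotheses (st : forall d, cmp (s d) (t d) = idm (F (G d))).
Hypotheses (ts : forall d, cmp (t d) (s d) = idm d).

Lemma quasi_inverse_id d :
  full_lift (cmp (s d) (cmp (idm d) (t d))) = idm (G d).
Proof. by apply: Ffaithful; rewrite full_liftK cmp_idl st fmap_id. Qed.

Lemma quasi_inverse_cmp x y z (g : hom y z) (f : hom x y) :
  full_lift (cmp (s z) (cmp (cmp g f) (t x))) =
  cmp (full_lift (cmp (s z) (cmp g (t y)))) (full_lift (cmp (s y) (cmp f (t x)))).
Proof.
apply: Ffaithful; rewrite fmap_cmp !full_liftK -!cmpA (cmpA (t y)).
by rewrite ts cmp_idl.
Qed.

(** Morphisms are conjugated by [t] and lifted along [F]. With [t] and [s] as parameters this serves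
    twice: arbitrary isomorphisms give an equivalence, those induced by equalities a strict
    inverse. *)
Definition quasi_inverse : functor D C :=
  @Functor D C G (fun x y g => full_lift (cmp (s y) (cmp g (t x))))
    quasi_inverse_id quasi_inverse_cmp.

Lemma fmap_quasi_inverse x y (g : hom x y) :
  cmp (t y) (fmap F (fmap quasi_inverse g)) = cmp g (t x).
Proof. by rewrite /= full_liftK cmpA ts cmp_idl. Qed.

End QuasiInverse.

Lemma equivalence_of_fully_faithful :
  (forall d, exists x (t : hom (F x) d), isomorphism t) ->
  equivalent_categories C D.
Proof.
move=> /choice [G].
move=> /(fun h d => cid (h d)) tP; pose t d := sval (tP d).
have sP d := cid (svalP (tP d)); pose s d := sval (sP d).
have st d : cmp (s d) (t d) = idm _ := (svalP (sP d)).1.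
have ts d : cmp (t d) (s d) = idm _ := (svalP (sP d)).2.
exists F, (quasi_inverse st ts); split.
  (* The isomorphism from [G (F x)] to [x] is the lift of [t (F x)]; its laws hold after applying
     the faithful [F]. *)
  exists (fun x => full_lift (t (F x))); split=> [x y f|x].
    by apply: Ffaithful; rewrite !fmap_cmp /= !full_liftK cmpA ts cmp_idl.
  exists (full_lift (s (F x))).
  by split; apply: Ffaithful; rewrite fmap_cmp !full_liftK fmap_id;
    [apply: st | apply: ts].
exists t; split=> [x y f|x]; first exact: fmap_quasi_inverse.
by exists (s x); split; [apply: st | apply: ts].
Qed.

(** Each [t d] comes from the equality [F (G d) = d], so its naturality squares are those required
    by [functor_eq]. On the other side injectivity gives [G (F x) = x], and faithfulness reflects
    the squares. *)
Lemma cat_isomorphism_of_fully_faithful :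
  (forall x y, F x = F y -> x = y) -> (forall d, exists x, F x = d) ->
  cat_isomorphism F.
Proof.
move=> Finj /choice [G FG].
pose t d := id_to_hom (FG d).
have sP d := cid (id_to_hom_iso (FG d)); pose s d := sval (sP d).
have st d : cmp (s d) (t d) = idm _ := (svalP (sP d)).1.
have ts d : cmp (t d) (s d) = idm _ := (svalP (sP d)).2.
pose H := quasi_inverse st ts; exists H; split.
  apply: (@functor_eq _ _ (cmp_functor H F) (id_functor C)
    (fun x => Finj _ _ (FG (F x)))) => x y f.
  apply: Ffaithful; rewrite !fmap_cmp !(fmap_id_to_hom _ (FG _)).
  exact: fmap_quasi_inverse.
apply: (@functor_eq _ _ (cmp_functor F H) (id_functor D) FG) => x y f.
exact: fmap_quasi_inverse.
Qed.

End FullyFaithful.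

(** * Sets *)

Definition upair (x y : V) : V := setof (fun b : bool => if b then x else y).

Lemma mem_upair z x y : z ∈ upair x y <-> z = x \/ z = y.
Proof.
rewrite mem_setof; split=> [[[] <-]|[->|->]]; [by left|by right| |].
  by exists true.
by exists false.
Qed.

Lemma upair_inj x y x' y' : upair x y = upair x' y' ->
  x = x' /\ y = y' \/ x = y' /\ y = x'.
Proof.
move=> E.
have xy z : (z = x \/ z = y) <-> (z = x' \/ z = y').
  by rewrite -!mem_upair E.
have := (xy x).1 (or_introl erefl); have := (xy y).1 (or_intror erefl).
have := (xy x').2 (or_introl erefl); have := (xy y').2 (or_intror erefl).
by intuition (subst; auto).
Qed.

(** Kuratowski's ordered pair. *)
Definition opair (x y : V) : V := upair (upair x x) (upair x y).

Lemma opair_inj x y x' y' : opair x y = opair x' y' -> x = x' /\ y = y'.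
Proof.
move=> /upair_inj [] [] /upair_inj E /upair_inj E'; by intuition congruence.
Qed.

(** The family is indexed through [idx], because [setof] needs a small type and [el A] lives in the
    universe of [V]. *)
Definition bigcupV (A : V) (U : el A -> V) : V :=
  setof (fun p : {d : idx A & idx (U (exist _ (elt d) (ex_intro _ d erefl)))} =>
    elt (tagged p)).

Lemma mem_bigcupV (A : V) (U : el A -> V) x :
  x ∈ bigcupV U <-> exists i, x ∈ U i.
Proof.
rewrite mem_setof; split=> [[[d e] <-]|[[i [d di]]]].
  by exists (exist _ (elt d) (ex_intro _ d erefl)), e.
by case: i / di => -[e ex]; exists (existT _ d e).
Qed.

(** * Algebras over [I] and their fibers *)

Section Algebras.
Variables (F : language) (I : Alg F).

Local Notation L := (sorted_language I).
Local Notation chi a := (slice_map a : alg_hom _ _).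

(** Arguments are matched by their underlying sets, since their types agree only once the sorts are
    identified. [comma_eq] uses the same device. *)
Lemma ms_algebra_eq (K : ms_language) (A B : ms_algebra K) :
  (forall i, ms_univ A i = ms_univ B i) ->
  (forall s (a : forall k, el (ms_univ A (@in_sort K s k)))
     (b : forall k, el (ms_univ B (in_sort k))),
     (forall k, sval (a k) = sval (b k)) ->
     sval (ms_op a) = sval (ms_op b)) ->
  A = B.
Proof.
case: A B => [U p] [W q] /= /funext E; case: _ / E q => q pq.
congr MSAlgebra; apply: functional_extensionality_dep => s; apply/funext => a.
by apply/el_inj/pq.
Qed.

Lemma ms_op_eq (K : ms_language) (A B : ms_algebra K) s
    (a : forall k, el (ms_univ A (@in_sort K s k)))
    (b : forall k, el (ms_univ B (in_sort k))) :
  A = B -> (forall k, sval (a k) = sval (b k)) ->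
  sval (ms_op a) = sval (ms_op b).
Proof.
move=> E; case: _ / E b => b ab; congr (sval (ms_op _)).
by apply: functional_extensionality_dep => k; apply/el_inj/ab.
Qed.

Lemma comma_eq (a b : comma I) :
  univ (slice_dom a) = univ (slice_dom b) ->
  (forall f (x : 'I_(ar f) -> el (univ (slice_dom a)))
     (y : 'I_(ar f) -> el (univ (slice_dom b))),
     (forall k, sval (x k) = sval (y k)) -> sval (op x) = sval (op y)) ->
  (forall x y, sval x = sval y -> chi a x = chi b y) ->
  a = b.
Proof.
case: a b => [[A p] [g gP]] [[B q] [h hP]] /= E.
case: _ / E q h hP => q h hP pq gh.
have E : p = q.
  apply: functional_extensionality_dep => f; apply/funext => x.
  by apply/el_inj/pq.
case: _ / E h hP gh {pq} => h hP gh.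
by congr SliceObj; apply: alg_hom_eq => x; apply: gh.
Qed.

Lemma fiberP (a : comma I) i x :
  x ∈ fiber (chi a) i <->
  exists y : el (univ (slice_dom a)), sval y = x /\ chi a y = i.
Proof.
rewrite mem_sep; split=> [[_ [Ax xi]]|[[y Ay] /= [<- yi]]].
  by exists (exist _ x Ax).
by split=> //; exists Ay.
Qed.

Lemma M_disjoint_sorts (a : comma I) : disjoint_sorts (M I a).
Proof.
move=> i j ij [x [/fiberP [y [yx yi]] /fiberP [z [zx zj]]]].
by apply: ij; rewrite -yi -zj; congr (chi a _); apply: el_inj; rewrite yx zx.
Qed.

Lemma onto_nonempty_sorts (a : comma I) : onto_obj a <-> nonempty_sorts (M I a).
Proof.
split=> aP i; first by have [x xi] := aP i; exists (sval x); apply/fiberP; exists x.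
by have [_ /fiberP [x [_ xi]]] := aP i; exists x.
Qed.

(** Every [x] lies in the fiber over its own image, where the restricted map keeps the value at
    [x]. *)
Lemma M_faithful : faithful (M I).
Proof.
move=> a b [f fE] [g gE] fg; apply: eq_exist; apply: alg_hom_eq => x.
apply: el_inj.
pose y : el (fiber (chi a) (chi a x)) := to_fiber erefl.
have xE : x = fiber_val y by apply: el_inj.
have := congr1 (fun h : ms_hom (M_obj a) (M_obj b) => sval (h _ y)) fg.
by rewrite /= -xE.
Qed.

(** * Gluing a multisorted homomorphism along the fibers *)

Section Glue.
Variables (a b : comma I) (g : ms_hom (M_obj a) (M_obj b)).

Definition glue (x : el (univ (slice_dom a))) : el (univ (slice_dom b)) :=
  fiber_val (g _ (to_fiber (erefl (chi a x)))).

Lemma glueE i (y : el (fiber (chi a) i)) :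
  sval (glue (fiber_val y)) = sval (g i y).
Proof.
have : sval (fiber_val y) = sval y by [].
(* Generalizing [fiber_val y] to an [x] over [i] lets [i] be replaced by [chi a x], the sort at
   which [glue] applies [g]. *)
rewrite /glue; move: (fiber_val y) (fiber_valP y) => x xi.
case: _ / xi y => y xy /=; congr (sval (g _ _)).
exact: el_inj.
Qed.

Lemma glue_map x : chi b (glue x) = chi a x.
Proof. exact: fiber_valP. Qed.

Lemma glue_op f (x : 'I_(ar f) -> el (univ (slice_dom a))) :
  glue (op x) = op (fun k => glue (x k)).
Proof.
pose args k : el (fiber (chi a) (chi a (x k))) := to_fiber erefl.
have xE k : x k = fiber_val (args k) by apply: el_inj.
(* The relevant symbol is the copy of [f] indexed by the images of the arguments. *)
have gop := @ms_funP _ _ _ g (existT _ f (fun k => chi a (x k))) args.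
apply: el_inj; have := congr1 sval gop; rewrite -glueE /= => <-.
congr (sval (glue _)); apply: el_inj => /=.
by congr (sval (op _)); apply/funext => k; apply: el_inj.
Qed.

End Glue.

Lemma M_full : full (M I).
Proof.
move=> a b g.
pose psi : @hom (Alg F) (slice_dom a) (slice_dom b) := AlgHom (glue_op g).
have mapE : slice_map a = cmp (slice_map b) psi.
  by apply: alg_hom_eq => x; rewrite /= glue_map.
exists (exist _ psi mapE); apply: ms_hom_eq => i x; apply: el_inj.
exact: glueE.
Qed.

Lemma M_obj_inj (a b : comma I) : M I a = M I b -> a = b.
Proof.
move=> ab.
have fibE i : fiber (chi a) i = fiber (chi b) i.
  exact: (congr1 (fun A : ms_algebra L => ms_univ A i) ab).
(* The structure map is read off from which fiber contains the element. *)
have chiE x y : sval x = sval y -> chi a x = chi b y.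
  move=> xy; have : sval x ∈ fiber (chi a) (chi a x) by apply: mem_fiber.
  rewrite fibE => /fiberP [z [zx <-]]; congr (chi b _).
  by apply: el_inj; rewrite zx.
apply: comma_eq => // [|f x y xy].
  apply: extV => x; split=> Ax.
    have : x ∈ fiber (chi a) (chi a (exist _ x Ax))
      by apply/fiberP; exists (exist _ x Ax).
    by rewrite fibE => /mem_sep [].
  have : x ∈ fiber (chi b) (chi b (exist _ x Ax))
      by apply/fiberP; exists (exist _ x Ax).
  by rewrite -fibE => /mem_sep [].
(* The value of [f] at [x] is a value of its copy indexed by the images of the [x k]; by [chiE] the
   [y k] lie in the same sorts. *)
pose s : ms_symb L := existT _ f (fun k => chi a (x k)).
pose u k : el (ms_univ (M_obj a) (@in_sort L s k)) := to_fiber erefl.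
pose v k : el (ms_univ (M_obj b) (@in_sort L s k)) :=
  to_fiber (esym (chiE _ _ (xy k))).
have := @ms_op_eq L (M_obj a) (M_obj b) s u v ab xy; rewrite /=.
have -> : (fun k => fiber_val (u k)) = x by apply/funext => k; apply: el_inj.
by have -> : (fun k => fiber_val (v k)) = y by apply/funext => k; apply: el_inj.
Qed.

(** * The algebra over [I] glued from disjoint sorts *)

Section Total.
Variables (B : ms_algebra L) (Bdisj : disjoint_sorts (B : MSAlg L)).

Local Notation total := (bigcupV (ms_univ B)).

(** The sort is obtained by choice; disjointness makes it the only possible one, see
    [total_sortE]. *)
Definition total_sort (x : el total) : el (univ I) :=
  sval (cid ((mem_bigcupV _ _).1 (svalP x))).

Definition total_proj (x : el total) : el (ms_univ B (total_sort x)) :=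
  exist _ (sval x) (svalP (cid ((mem_bigcupV _ _).1 (svalP x)))).

Definition total_in i (y : el (ms_univ B i)) : el total :=
  exist _ (sval y) ((mem_bigcupV _ _).2 (ex_intro _ i (svalP y))).

Lemma total_sortE i (x : el total) : sval x ∈ ms_univ B i -> total_sort x = i.
Proof.
move=> xi; apply: contrapT => /Bdisj; apply.
by exists (sval x); split=> //; apply: svalP (total_proj x).
Qed.

Lemma total_sort_in i (y : el (ms_univ B i)) : total_sort (total_in y) = i.
Proof. by apply: total_sortE; apply: svalP y. Qed.

Definition total_op f (x : 'I_(ar f) -> el total) : el total :=
  total_in (@ms_op _ B (existT _ f (fun k => total_sort (x k)))
    (fun k => total_proj (x k))).

(** The chosen sorts of the [x k] equal the [i k] only propositionally, so [y] provides the same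
    arguments typed in the sorts [i k]. *)
Lemma val_total_op f (i : 'I_(ar f) -> el (univ I)) (x : 'I_(ar f) -> el total)
    (y : forall k, el (ms_univ B (i k))) :
  (forall k, sval (x k) = sval (y k)) ->
  sval (total_op x) = sval (@ms_op L B (existT _ f i) y).
Proof.
move=> xy.
have xi : (fun k => total_sort (x k)) = i.
  by apply/funext => k; apply: total_sortE; rewrite xy; apply: svalP (y k).
case: _ / xi y xy => y xy; congr (sval (ms_op _)).
by apply: functional_extensionality_dep => k; apply/el_inj/xy.
Qed.

Definition total_alg : algebra F := Algebra total_op.

(** The output sort of a symbol of [sorted_language] is by definition the value of [f] in [I] at its
    input sorts. *)
Lemma total_sort_op f (x : 'I_(ar f) -> el (univ total_alg)) :
  total_sort (op x) = op (fun k => total_sort (x k)).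
Proof. exact: total_sort_in. Qed.

Definition total_comma : comma I :=
  @SliceObj (Alg F) I total_alg (@AlgHom _ total_alg I total_sort total_sort_op).

(** An equality and not just an isomorphism: by disjointness the fiber over [i] is the very set
    [ms_univ B i]. *)
Lemma M_total : M I total_comma = B.
Proof.
apply: ms_algebra_eq => [i|[f i] x y xy].
  apply: extV => x; rewrite fiberP; split=> [[y [<- <-]]|xi].
    exact: svalP (total_proj y).
  by exists (total_in (exist _ x xi)); split=> //; apply: total_sortE.
exact: (@val_total_op f i (fun k => fiber_val (x k)) y xy).
Qed.

End Total.

(** * Making the sorts disjoint *)

Section Disjointification.
Variable A : ms_algebra L.

Definition tagged_univ (i : el (univ I)) : V :=
  setof (fun d : idx (ms_univ A i) => opair (sval i) (elt d)).

Lemma mem_tagged_univ i x :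
  x ∈ tagged_univ i <-> exists y : el (ms_univ A i), opair (sval i) (sval y) = x.
Proof.
rewrite mem_setof; split=> [[d <-]|[[y [d /= <-]] <-]]; last by exists d.
by exists (exist _ (elt d) (ex_intro _ d erefl)).
Qed.

Definition untag i (x : el (tagged_univ i)) : el (ms_univ A i) :=
  sval (cid ((mem_tagged_univ _ _).1 (svalP x))).

Definition tag_el i (y : el (ms_univ A i)) : el (tagged_univ i) :=
  exist (fun x => x ∈ tagged_univ i) (opair (sval i) (sval y))
    ((mem_tagged_univ _ _).2 (ex_intro _ y erefl)).

Lemma untagK i : cancel (@untag i) (@tag_el i).
Proof.
move=> x; apply: el_inj.
exact: svalP (cid ((mem_tagged_univ _ _).1 (svalP x))).
Qed.

(** [untagK] at [tag_el y] equates two ordered pairs; the second components give the claim. *)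
Lemma tag_elK i : cancel (@tag_el i) (@untag i).
Proof.
move=> y; apply: el_inj.
by have /(congr1 sval)/opair_inj [] := untagK (tag_el y).
Qed.

Definition tagged_alg : ms_algebra L :=
  @MSAlgebra L tagged_univ (fun s x => tag_el (ms_op (fun k => untag (x k)))).

Lemma tagged_alg_disjoint : disjoint_sorts (tagged_alg : MSAlg L).
Proof.
move=> i j ij [x [/mem_tagged_univ [y <-] /mem_tagged_univ [z /opair_inj [ji _]]]].
by apply: ij; apply: el_inj.
Qed.

Lemma tagged_alg_iso :
  exists t : hom (tagged_alg : MSAlg L) (A : MSAlg L), isomorphism t.
Proof.
have untag_op s x :
    untag (@ms_op L tagged_alg s x) = ms_op (fun k => untag (x k)).
  exact: tag_elK.
have tag_op s x :
    tag_el (@ms_op L A s x) = @ms_op L tagged_alg s (fun k => tag_el (x k)).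
  congr (tag_el (ms_op _)); apply: functional_extensionality_dep => k.
  by rewrite tag_elK.
exists (@MSHom L tagged_alg A _ untag_op), (@MSHom L A tagged_alg _ tag_op).
by split; apply: ms_hom_eq => i x; [apply: untagK | apply: tag_elK].
Qed.

Lemma tagged_alg_nonempty :
  nonempty_sorts (A : MSAlg L) -> nonempty_sorts (tagged_alg : MSAlg L).
Proof.
move=> A0 i; have [x xi] := A0 i.
by exists (sval (tag_el (exist _ x xi))); apply: svalP (tag_el _).
Qed.

End Disjointification.

End Algebras.

Theorem theorem2p4 (F : language) (I : Alg F)
    (I_nonempty : exists i, i ∈ univ I) :
  maps_onto_full_sub (M I) (@disjoint_sorts (sorted_language I)) /\
  (exists M_disjoint : forall a : comma I, disjoint_sorts (M I a),
     cat_isomorphism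
       (corestrict M_disjoint
          : functor (comma I) (MSAlg_box (sorted_language I)))) /\
  (exists M_onto : forall a : comma I,
       onto_obj a -> disjoint_nonempty_sorts (M I a),
     cat_isomorphism
       (restrict M_onto
          : functor (comma_onto I) (MSAlg_boxplus (sorted_language I)))) /\
  equivalent_categories (comma I) (MSAlg (sorted_language I)) /\
  equivalent_categories (comma_onto I) (MSAlg_plus (sorted_language I)).
Proof.
have M_onto (a : comma I) : onto_obj a -> disjoint_nonempty_sorts (M I a).
  by move=> /onto_nonempty_sorts; split=> //; apply: M_disjoint_sorts.
have M_plus (a : comma I) : onto_obj a -> nonempty_sorts (M I a).
  by move=> /M_onto [].
split; [|split; [|split; [|split]]].
- split=> [y|]; last exact: M_full.
  split=> [yd|[x <-]]; last exact: M_disjoint_sorts.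
  by exists (total_comma yd); apply: M_total.
- exists (@M_disjoint_sorts F I).
  apply: cat_isomorphism_of_fully_faithful => [x y g|x y f g|x y E|[B Bd]].
  + exact: M_full.
  + exact: M_faithful.
  + exact/M_obj_inj/(congr1 sval E).
  + by exists (total_comma Bd); apply: eq_exist; apply: M_total.
- exists M_onto.
  apply: cat_isomorphism_of_fully_faithful
    => [x y g|x y f g|[x xo] [y yo] E|[B [Bd B0]]].
  + exact: M_full.
  + exact: M_faithful.
  + exact/eq_exist/M_obj_inj/(congr1 sval E).
  + have MB := M_total Bd.
    (* The fibers are the sorts of [B], nonempty by [B0]. *)
    have Bo : onto_obj (total_comma Bd) by apply/onto_nonempty_sorts; rewrite MB.
    by exists (exist _ _ Bo); apply: eq_exist.
- apply: equivalence_of_fully_faithful (@M_full F I) (@M_faithful F I) _ => B.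
  (* The image of this object is the tagged copy of [B] itself. *)
  exists (total_comma (@tagged_alg_disjoint F I B)); rewrite M_total.
  exact: tagged_alg_iso.
- apply: (@equivalence_of_fully_faithful _ _ (restrict M_plus))
    => [x y g|x y f g|[B B0]].
  + exact: M_full.
  + exact: M_faithful.
  + have MB := M_total (@tagged_alg_disjoint F I B).
    have Bo : onto_obj (total_comma (@tagged_alg_disjoint F I B)).
      by apply/onto_nonempty_sorts; rewrite MB; apply: tagged_alg_nonempty.
    exists (exist _ _ Bo).
    (* Isomorphisms in a full subcategory are those of the ambient category, where [MB] can be
       rewritten. *)
    suff [t tP] : exists t : hom (M I (total_comma (@tagged_alg_disjoint F I B))) B,
        isomorphism t by exists t; exact: tP.
    by rewrite MB; apply: tagged_alg_iso.
Qed.
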